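(* For each of the following classes of groups $G$, elements $g\in G-\{1\}$, and positive integers $n$, every element $c\neq 0$ of a field $k$ satisfying $c^n\neq 1$ has the property that $g-c\in k\,G$ generates the improper ideal of $k\,G$. (a) $G$ any group having a nonidentity element $g$ of finite order, and any $n>1$ such that $g^n=1$. (b) $G$ the group of affine maps of the real line generated by the elements $g$ and $h$, where $g(t)=t+1$ and $h(t)=\alpha\,t$ $(t\in \mathbb{R})$ for a rational number $\alpha= m/m'\neq 1,0$ (with $m,m'$ integers), with $n=|m-m'|$. (c) $G$ any group containing elements $h\neq h'$ such that $h^n={h'}^n$ for some $n>1$, with $g=h^{-1}h'$. (d) $G$ any group containing elements $h_1$, $h_2$ which do not commute, but such that for some $n>1$, $h_1$ commutes with $h_2^n$, with $g=[h_2,h_1]$. Hence no group with any of the indicated properties is resistant.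
   Context: For group elements $x,y$, $[x,y]=x^{-1}y^{-1}xy$. For a field $k$ and group $G$, $k\,G$ is the group algebra; ''ideal'' means two-sided ideal, and an element ''generates the improper ideal'' if the two-sided ideal it generates is all of $k\,G$. The support of $r=\sum_{g\in G}c_g\,g\in k\,G$ is $\{g\mid c_g\neq 0\}$. A group $G$ is called resistant if for every field $k$ and every element $r\in k\,G$ whose support has cardinality $>1$, the two-sided ideal of $k\,G$ generated by $r$ is proper. *)

(* Defs.v *)
From HB Require Import structures.
From mathcomp Require Import all_boot all_order all_algebra.
From mathcomp Require Import finmap monalg.
From mathcomp Require Import boolp classical_sets reals.

Set Implicit Arguments.
Unset Strict Implicit.
Unset Printing Implicit Defensive.

Import GRing.Theory Num.Theory.

Local Open Scope fset_scope.
Local Open Scope ring_scope.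

(* [malg] is only a ring when its basis is a [monomType], which rules out
   nontrivial groups (x * y = 1 forces x = y = 1); hence only the module
   structure of [malg] is reused here. *)
Definition group_algebra (k : fieldType) (G : groupType) : Type :=
  {malg k[G]}.

Section GroupAlgebra.
Variables (k : fieldType) (G : groupType).
Local Notation kG := (group_algebra k G).

HB.instance Definition _ := GRing.Lmodule.on kG.

Implicit Types (r s t : kG) (g h : G).

Definition gelt g : kG := << 1 *g g >>.

Definition gmul r s : kG :=
  \sum_(g <- msupp r) \sum_(h <- msupp s) << r@_g * s@_h *g (g * h)%g >>.

Let gmulw (d1 d2 : {fset G}) r s :
  msupp r `<=` d1 -> msupp s `<=` d2 ->
  gmul r s = \sum_(g <- d1) \sum_(h <- d2) << r@_g * s@_h *g (g * h)%g >>.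
Proof.
move=> le_d1 le_d2; rewrite /gmul (big_fset_incl _ le_d1) /=.
  apply/eq_bigr=> g _; apply/big_fset_incl => // h _ /mcoeff_outdom ->.
  by rewrite mulr0 monalgU0.
move=> g _ /mcoeff_outdom rg.
by rewrite big1 => // h _; rewrite rg mul0r monalgU0.
Qed.

Let gmul0r : left_zero 0 gmul.
Proof. by move=> r; rewrite /gmul msupp0 big_seq_fset0. Qed.

Let gmulr0 : right_zero 0 gmul.
Proof. by move=> r; rewrite /gmul exchange_big msupp0 big_seq_fset0. Qed.

Let gmulUU (a b : k) g h :
  gmul << a *g g >> << b *g h >> = << a * b *g (g * h)%g >>.
Proof. by rewrite (gmulw msuppU_le msuppU_le) !big_seq_fset1 !mcoeffUU. Qed.

Let gmulDl : left_distributive gmul +%R.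
Proof.
move=> r s t; have st := fsubset_refl (msupp t).
rewrite (gmulw (msuppD_le r s) st).
rewrite (gmulw (fsubsetUl (msupp r) (msupp s)) st).
rewrite (gmulw (fsubsetUr (msupp r) (msupp s)) st).
rewrite -big_split /=; apply/eq_bigr=> g _.
rewrite -big_split /=; apply/eq_bigr=> h _.
by rewrite mcoeffD mulrDl monalgUD.
Qed.

Let gmulDr : right_distributive gmul +%R.
Proof.
move=> t r s; have st := fsubset_refl (msupp t).
rewrite (gmulw st (msuppD_le r s)).
rewrite (gmulw st (fsubsetUl (msupp r) (msupp s))).
rewrite (gmulw st (fsubsetUr (msupp r) (msupp s))).
rewrite -big_split /=; apply/eq_bigr=> g _.
rewrite -big_split /=; apply/eq_bigr=> h _.
by rewrite mcoeffD mulrDr monalgUD.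
Qed.

Let gmul_suml I (d : seq I) (F : I -> kG) s :
  gmul (\sum_(i <- d) F i) s = \sum_(i <- d) gmul (F i) s.
Proof. exact: (big_morph (gmul^~ s) (fun _ _ => gmulDl _ _ _) (gmul0r s)). Qed.

Let gmul_sumr I (d : seq I) (F : I -> kG) s :
  gmul s (\sum_(i <- d) F i) = \sum_(i <- d) gmul s (F i).
Proof. exact: (big_morph (gmul s) (fun _ _ => gmulDr _ _ _) (gmulr0 s)). Qed.

Let monE r : r = \sum_(g <- msupp r) (<< r@_g *g g >> : kG).
Proof. exact: monalgE. Qed.

Let gmulA : associative gmul.
Proof.
move=> r s t; rewrite [r]monE !gmul_suml; apply/eq_bigr => g _.
rewrite [s]monE gmul_suml !gmul_sumr gmul_suml; apply/eq_bigr => h _.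
rewrite [t]monE !gmul_sumr; apply/eq_bigr => i _.
by rewrite !gmulUU mulrA mulgA.
Qed.

Let gmul1r : left_id (gelt 1%g) gmul.
Proof.
move=> r; rewrite [in LHS](monE r) gmul_sumr [RHS]monE.
by apply/eq_bigr => g _; rewrite gmulUU mul1r mul1g.
Qed.

Let gmulr1 : right_id (gelt 1%g) gmul.
Proof.
move=> r; rewrite [in LHS](monE r) gmul_suml [RHS]monE.
by apply/eq_bigr => g _; rewrite gmulUU mulr1 mulg1.
Qed.

Let gelt1_neq0 : gelt 1%g != 0.
Proof. by rewrite monalgU_eq0 oner_eq0. Qed.

HB.instance Definition _ := GRing.Zmodule_isNzRing.Build kG
  gmulA gmul1r gmulr1 gmulDl gmulDr gelt1_neq0.

Let scale_mon (c a : k) g : c *: (<< a *g g >> : kG) = << c * a *g g >>.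
Proof. by apply/malgP => h; rewrite mcoeffZ !mcoeffU mulrnAr. Qed.

Let gscaleAl (c : k) r s : c *: (r * s) = (c *: r) * s.
Proof.
change (c *: gmul r s = gmul (c *: r) s).
rewrite [r]monE gmul_suml !scaler_sumr gmul_suml; apply/eq_bigr => g _.
rewrite [s]monE !gmul_sumr scaler_sumr.
by apply/eq_bigr => h _; rewrite scale_mon !gmulUU scale_mon mulrA.
Qed.

HB.instance Definition _ := GRing.Lmodule_isLalgebra.Build k kG gscaleAl.

Let gscaleAr (c : k) r s : c *: (r * s) = r * (c *: s).
Proof.
change (c *: gmul r s = gmul r (c *: s)).
rewrite [r]monE !gmul_suml scaler_sumr; apply/eq_bigr => g _.
rewrite [s]monE gmul_sumr !scaler_sumr gmul_sumr.
by apply/eq_bigr => h _; rewrite scale_mon !gmulUU scale_mon mulrCA.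
Qed.

HB.instance Definition _ := GRing.Lalgebra_isAlgebra.Build k kG gscaleAr.

Lemma gelt1 : gelt 1%g = 1.
Proof. by []. Qed.

Lemma geltM g h : gelt (g * h)%g = gelt g * gelt h.
Proof. by symmetry; apply: etrans (gmulUU 1 1 g h) _; rewrite mulr1. Qed.

End GroupAlgebra.

Arguments gelt {k G} g.

Definition two_sided_ideal (A : nzRingType) (I : set A) : Prop :=
  [/\ I 0,
      forall x y, I x -> I y -> I (x + y),
      forall a x, I x -> I (a * x)
    & forall a x, I x -> I (x * a)].

Definition ideal_gen (A : nzRingType) (r : A) : set A :=
  smallest (@two_sided_ideal A) [set r]%classic.

Definition resistant (G : groupType) : Prop :=
  forall (k : fieldType) (r : group_algebra k G),
    (1 < #|` msupp r|)%N -> ideal_gen r <> [set: group_algebra k G]%classic.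

Definition subgroup (G : groupType) (H : set G) : Prop :=
  [/\ H 1%g,
      forall x y, H x -> H y -> H (x * y)%g
    & forall x, H x -> H (x^-1)%g].

Definition gen_pred (G : groupType) (S : set G) : pred G :=
  fun x => x \in smallest (@subgroup G) S.

Definition gen_group (G : groupType) (S : set G) : Type :=
  {x : G | gen_pred S x}.

Section GenGroup.
Variables (G : groupType) (S : set G).

Let gen_closed : group_closed (gen_pred S).
Proof.
split=> [|x y]; rewrite -!topredE /=.
  by apply/mem_set => H [[]].
move=> /set_mem Sx /set_mem Sy; apply/mem_set => H HS.
case: (HS) => -[_ HM HV] _.
by apply: HM; [exact: Sx|apply: HV; exact: Sy].
Qed.

HB.instance Definition _ := SubChoice.on (gen_group S).
HB.instance Definition _ :=
  SubChoice_isSubGroup.Build G (gen_pred S) (gen_group S) gen_closed.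

End GenGroup.

(* The pair (a, b), a != 0, encodes the affine map t |-> a * t + b. *)
Definition affine (R : realType) : Type := {p : R * R | p.1 != 0}.

Definition affine_fun (R : realType) (f : affine R) (t : R) : R :=
  (val f).1 * t + (val f).2.
Coercion affine_fun : affine >-> Funclass.

Section Affine.
Variable R : realType.

HB.instance Definition _ := Choice.on (affine R).

Implicit Types f g h : affine R.

Let aff_mul_proof f g : (val f).1 * (val g).1 != 0.
Proof. by rewrite mulf_neq0 ?(valP f) ?(valP g). Qed.

Definition aff_mul f g : affine R :=
  exist _ ((val f).1 * (val g).1, f (val g).2) (aff_mul_proof f g).

Definition aff_one : affine R := exist _ (1, 0) (oner_neq0 R).

Let aff_inv_proof f : (val f).1^-1 != 0.
Proof. by rewrite invr_eq0 (valP f). Qed.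

Definition aff_inv f : affine R :=
  exist _ ((val f).1^-1, - ((val f).1^-1 * (val f).2)) (aff_inv_proof f).

Let aff_mulA : associative aff_mul.
Proof.
move=> f g h; apply/val_inj; rewrite /= /affine_fun /= mulrA; congr pair.
by rewrite mulrDr mulrA addrA.
Qed.

Let aff_mul1f : left_id aff_one aff_mul.
Proof.
move=> f; apply/val_inj; rewrite /= /affine_fun /= !mul1r addr0.
by rewrite -surjective_pairing.
Qed.

Let aff_mulf1 : right_id aff_one aff_mul.
Proof.
move=> f; apply/val_inj; rewrite /= /affine_fun /= mulr1 mulr0 add0r.
by rewrite -surjective_pairing.
Qed.

Let aff_mulVf : left_inverse aff_one aff_inv aff_mul.
Proof.
move=> f; apply/val_inj; rewrite /= /affine_fun /= mulVf ?(valP f) //.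
by rewrite subrr.
Qed.

Let aff_mulfV : right_inverse aff_one aff_inv aff_mul.
Proof.
move=> f; apply/val_inj; rewrite /= /affine_fun /= mulfV ?(valP f) //.
by rewrite mulrN mulrA mulfV ?(valP f) // mul1r addNr.
Qed.

HB.instance Definition _ := isGroup.Build (affine R)
  aff_mulA aff_mul1f aff_mulf1 aff_mulVf aff_mulfV.

Lemma affineM f g (t : R) : (f * g : affine R)%g t = f (g t).
Proof.
by rewrite /affine_fun /= /affine_fun mulrDr mulrA addrA.
Qed.

Lemma affine_inj f g : f =1 g -> f = g.
Proof.
move=> fg; apply/val_inj; move: (fg 0) (fg 1).
rewrite /affine_fun !mulr0 !add0r !mulr1 => eb; rewrite eb => /addIr ea.
by rewrite [LHS]surjective_pairing [RHS]surjective_pairing ea eb.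
Qed.

Lemma affine_exists (a b : R) :
  a != 0 -> exists f : affine R, forall t, f t = a * t + b.
Proof. by move=> a0; exists (exist _ (a, b) a0). Qed.

End Affine.

(* In the affine case the group is the subgroup generated by g and h, so the
   distinguished element is the member g0 of that subgroup lying over g. *)
Inductive admissible : forall G : groupType, G -> nat -> Prop :=
| admissible_torsion (G : groupType) (g : G) (n : nat) :
    g <> 1%g -> (1 < n)%N -> (g ^+ n)%g = 1%g ->
    admissible g n
| admissible_affine (R : realType) (m m' : int) (alpha : rat) (g h : affine R)
    (g0 : gen_group [set g; h]%classic) :
    m' != 0 -> alpha = m%:~R / m'%:~R -> alpha != 1 -> alpha != 0 ->
    (forall t : R, g t = t + 1) ->
    (forall t : R, h t = ratr alpha * t) ->
    val g0 = g ->
    admissible g0 `|m - m'|%N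
| admissible_equal_powers (G : groupType) (h h' : G) (n : nat) :
    h <> h' -> (1 < n)%N -> (h ^+ n)%g = (h' ^+ n)%g ->
    admissible (h^-1 * h')%g n
| admissible_commuting_power (G : groupType) (h1 h2 : G) (n : nat) :
    ~ commute h1 h2 -> (1 < n)%N -> commute h1 (h2 ^+ n)%g ->
    admissible [~ h2, h1]%g n.

(* Main.v *)
Require Import Defs.
From mathcomp Require Import all_boot all_order all_algebra.
From mathcomp Require Import finmap monalg.
From mathcomp Require Import boolp classical_sets reals.

(** Let I be the two-sided ideal generated by g - c.  Modulo I the group
    element g is the central scalar c, so any identity in G in which g occurs
    turns into a relation between group elements and powers of c.  As soon as
    such a relation says d x = 0 with d a nonzero scalar and x a group element,
    the unit d x lies in I, and I is everything
    ([two_sided_ideal_scaled_gelt]).  Two relations cover the four cases.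

    - If g = h^-1 h' with h^n = h'^n, then h' is congruent to c h, and raising
      to the n-th power gives (1 - c^n) h^n = 0, because scalars are central
      ([ideal_gen_equal_powers]).  The torsion case takes h = 1.  The commutator
      [h2, h1] is h2^-1 times the conjugate of h2 by h1, and the two have the
      same n-th power as soon as h1 commutes with h2^n.

    - If y conjugates g^p to g^(r - q), the scalar c^p is unchanged by
      conjugation, so c^(p + q) = c^r modulo I ([ideal_gen_conjugate_powers]).
      In the affine group, conjugating a translation by the dilation of ratio
      alpha multiplies its length by alpha, so the translations by m' and by m
      are conjugate; p, q and r only serve to write this without negative
      exponents.

    Over the rationals c = 2 satisfies c^n <> 1 for every n > 0, and g - 2 has
    two elements in its support, so none of these groups is resistant. *)

Set Implicit Arguments.
Unset Strict Implicit.
Unset Printing Implicit Defensive.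

Import Order.TTheory GRing.Theory Num.Theory.

Local Open Scope ring_scope.

(** * Congruences modulo a two-sided ideal *)

Lemma ideal_gen_ideal (A : nzRingType) (r : A) : two_sided_ideal (ideal_gen r).
Proof.
split=> [J [[]] //|x y Ix Iy J JP|a x Ix J JP|a x Ix J JP].
- by case: (JP) => -[_ JD _ _] _; apply: JD; [exact: Ix|exact: Iy].
- by case: (JP) => -[_ _ JM _] _; apply: JM; exact: Ix.
- by case: (JP) => -[_ _ _ JM] _; apply: JM; exact: Ix.
Qed.

Lemma ideal_gen_mem (A : nzRingType) (r : A) : ideal_gen r r.
Proof. exact: sub_gen_smallest. Qed.

Section Congruence.
Variables (A : nzRingType) (I : set A).
Hypothesis idealI : two_sided_ideal I.
Implicit Types a b x y z : A.

Definition eq_mod x y : Prop := I (x - y).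

Lemma eq_mod_refl x : eq_mod x x.
Proof. by rewrite /eq_mod subrr; case: idealI. Qed.

Lemma eq_mod_sym x y : eq_mod x y -> eq_mod y x.
Proof.
case: idealI => _ _ IM _ /(IM (-1)).
by rewrite mulN1r opprB.
Qed.

Lemma eq_mod_trans x y z : eq_mod x y -> eq_mod y z -> eq_mod x z.
Proof.
case: idealI => _ ID _ _ Ixy Iyz.
by rewrite /eq_mod -(subrKA y); exact: ID.
Qed.

Lemma eq_modM x y a b : eq_mod x y -> eq_mod a b -> eq_mod (x * a) (y * b).
Proof.
case: idealI => _ _ IMl IMr Ixy Iab; apply: (@eq_mod_trans _ (y * a)).
  by rewrite /eq_mod -mulrBl; exact: IMr.
by rewrite /eq_mod -mulrBr; exact: IMl.
Qed.

Lemma eq_modX n x y : eq_mod x y -> eq_mod (x ^+ n) (y ^+ n).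
Proof.
move=> Ixy; elim: n => [|n IHn]; first exact: eq_mod_refl.
by rewrite !exprS; exact: eq_modM.
Qed.

End Congruence.

Arguments eq_mod_refl {A I} idealI x.
Arguments eq_mod_sym {A I} idealI {x y}.
Arguments eq_mod_trans {A I} idealI {x y z}.
Arguments eq_modM {A I} idealI {x y a b}.
Arguments eq_modX {A I} idealI n {x y}.

(** * Group elements inside the group algebra *)

Section GroupElements.
Variables (k : fieldType) (G : groupType).
Local Notation kG := (group_algebra k G).
Implicit Types (c d : k) (x y g h : G).

Lemma geltX g n : gelt (g ^+ n)%g = gelt g ^+ n :> kG.
Proof.
elim: n => [|n IHn]; first by rewrite expg0 expr0 gelt1.
by rewrite expgS geltM IHn exprS.
Qed.

(** Nonzero multiples of group elements are units of the group algebra. *)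
Lemma two_sided_ideal_scaled_gelt (I : set kG) d x :
  two_sided_ideal I -> d != 0 -> I (d *: gelt x) -> I = [set: kG]%classic.
Proof.
case=> _ _ IM _ d0 Idx; apply/seteqP; split=> // a _.
have -> : a = (a * (d^-1 *: gelt x^-1%g)) * (d *: gelt x).
  rewrite -mulrA -scalerAl -!scalerAr scalerA mulVf // scale1r.
  by rewrite -geltM mulVg mulr1.
exact: IM.
Qed.

(** Left multiplication by h turns the congruence of h^-1 h' with c into
    h' = c h; as c is central, n-th powers give h'^n = c^n h^n although h and
    h' need not commute, and h'^n is also h^n. *)
Lemma ideal_gen_equal_powers h h' n c :
  (h ^+ n = h' ^+ n)%g -> c ^+ n != 1 ->
  ideal_gen (gelt (h^-1 * h')%g - c%:A) = [set: kG]%classic.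
Proof.
move=> hX cn1; set I := ideal_gen _.
have idI : two_sided_ideal I by exact: ideal_gen_ideal.
have gc : eq_mod I (gelt (h^-1 * h')%g) c%:A by exact: ideal_gen_mem.
have hh' : eq_mod I (gelt h') (c *: gelt h).
  have := eq_modM idI (eq_mod_refl idI (gelt h)) gc.
  by rewrite -geltM mulVKg -scalerAr mulr1.
have := eq_modX idI n hh'; rewrite exprZn -!geltX -hX /eq_mod.
rewrite -{1}[gelt _]scale1r -scalerBl.
by apply: two_sided_ideal_scaled_gelt => //; rewrite subr_eq0 eq_sym.
Qed.

(** A group element that is scalar modulo an ideal has all its conjugates
    congruent to the same scalar, so both sides of the relation are scalars,
    and these are distinct. *)
Lemma ideal_gen_conjugate_powers g y p q r c :
  ((g ^+ p) ^ y * g ^+ q = g ^+ r)%g -> c ^+ (p + q) != c ^+ r ->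
  ideal_gen (gelt g - c%:A) = [set: kG]%classic.
Proof.
move=> gE cpqr; set I := ideal_gen _.
have idI : two_sided_ideal I by exact: ideal_gen_ideal.
have gc : eq_mod I (gelt g) c%:A by exact: ideal_gen_mem.
have gX n : eq_mod I (gelt (g ^+ n)%g) (c ^+ n)%:A.
  rewrite geltX -{1}(expr1n kG n) -exprZn.
  exact: (eq_modX idI n gc).
have gJ : eq_mod I (gelt (g ^+ p ^ y)%g) (c ^+ p)%:A.
  have := eq_modM idI (eq_mod_refl idI (gelt y^-1%g))
    (eq_modM idI (gX p) (eq_mod_refl idI (gelt y))).
  by rewrite -!geltM -scalerAl mul1r -scalerAr -geltM mulVg.
have := eq_modM idI gJ (gX q).
rewrite -geltM gE -scalerAl mul1r scalerA -exprD => /(eq_mod_sym idI) cgr.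
have := eq_mod_trans idI cgr (gX r); rewrite /eq_mod -scalerBl -gelt1.
by apply: two_sided_ideal_scaled_gelt => //; rewrite subr_eq0.
Qed.

Lemma card_msupp_gelt_sub_scalar g c :
  g <> 1%g -> c != 0 -> #|` msupp (gelt g - c%:A : kG)| = 2.
Proof.
move=> /eqP g1 c0.
suff -> : msupp (gelt g - c%:A : kG) = [fset g; 1%g]%fset by rewrite cardfs2 g1.
apply/fsetP => x; rewrite in_fset2 -mcoeff_neq0.
rewrite -gelt1 mcoeffB mcoeffZ !mcoeffU.
have [->|xg] := eqVneq x g.
  by rewrite [1%g == _]eq_sym (negPf g1) mulr0 subr0 oner_eq0.
rewrite /= sub0r oppr_eq0 [1%g == _]eq_sym.
by case: (x == 1%g); rewrite ?mulr0 ?mulr1 ?eqxx.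
Qed.

End GroupElements.

(** * Translations and dilations of the line *)

Lemma expf_distn_eq1 (k : fieldType) (c : k) (p r : nat) :
  c != 0 -> c ^+ p = c ^+ r -> c ^+ `|p - r|%N = 1.
Proof.
move=> c0; wlog le_rp : p r / (r <= p)%N => [hw|].
  have [/hw//|/ltnW/hw hw' e] := leqP r p; rewrite distnC; exact: hw'.
move=> e; apply: (mulIf (expf_neq0 r c0)).
by rewrite distnEl // -exprD subnK // mul1r.
Qed.

(** The relation alpha * m' = m with natural numbers only, so that it can be
    read in the exponents of a group element: p is the absolute value of m',
    and that of m goes to q or to r according to the sign of alpha. *)
Lemma fraction_natural_relation (m m' : int) (alpha : rat) :
  m' != 0 -> alpha = m%:~R / m'%:~R ->
  exists p q r : nat,
    alpha * p%:R + q%:R = r%:R /\ `|m - m'|%N = `|(p + q)%N - r|%N.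
Proof.
wlog m'_gt0 : m m' / 0 < m' => [hw m'0 alphaE|].
  have [m'_gt0|m'_le0] := ltP 0 m'; first exact: (hw m m').
  have m'_lt0 : m' < 0 by rewrite lt_neqAle m'0.
  have alphaNE : alpha = (- m)%:~R / (- m')%:~R.
    by rewrite !rmorphN invrN mulrNN.
  have [p [q [r [e d]]]] : exists p q r : nat,
      alpha * p%:R + q%:R = r%:R /\ `|- m - - m'|%N = `|(p + q)%N - r|%N.
    by apply: hw alphaNE; rewrite ?oppr_gt0 ?oppr_eq0.
  by exists p, q, r; split=> //; rewrite -d -opprD abszN.
case: m' m'_gt0 => // p _ p0 alphaE.
have alpha_p : alpha * p%:R = m%:~R by rewrite alphaE mulfVK // intr_eq0.
case: m alphaE alpha_p => s _ alpha_p.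
  by exists p, 0%N, s; rewrite alpha_p addr0 addn0 distnC.
exists p, s.+1, 0%N; rewrite alpha_p NegzE rmorphN /= addNr; split=> //.
by rewrite -opprD abszN addn0 -PoszD addnC.
Qed.

Section Affine.
Variables (R : realType) (g h : affine R) (alpha : R).
Hypothesis gE : forall t, g t = t + 1.
Hypothesis hE : forall t, h t = alpha * t.

Lemma translation_exp n t : (g ^+ n : affine R)%g t = t + n%:R.
Proof.
elim: n t => [|n IHn] t.
  by rewrite expg0 addr0 /affine_fun /= mul1r addr0.
by rewrite expgS affineM IHn gE -addrA -natr1.
Qed.

Lemma translation_neq1 : g <> 1%g.
Proof.
move=> g1; have := gE 0; rewrite g1 /affine_fun /= mulr0 !add0r => /esym/eqP.
by rewrite oner_eq0.
Qed.

Lemma dilation_conj_translation p q r : alpha * p%:R + q%:R = r%:R ->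
  ((g ^+ p) ^ h^-1 * g ^+ q = g ^+ r)%g.
Proof.
move=> pqr; apply: affine_inj => t.
rewrite conjgE invgK !affineM translation_exp hE translation_exp mulrDr -hE.
by rewrite -affineM mulgV {1}/affine_fun /= mul1r addr0 translation_exp -addrA
  [q%:R + _]addrC pqr.
Qed.

End Affine.

Lemma generated_translation_relation (R : realType) (g h : affine R)
    (g0 : gen_group [set g; h]%classic) (alpha : R) (p q r : nat) :
  (forall t, g t = t + 1) -> (forall t, h t = alpha * t) -> val g0 = g ->
  alpha * p%:R + q%:R = r%:R ->
  exists y, ((g0 ^+ p) ^ y * g0 ^+ q = g0 ^+ r)%g.
Proof.
move=> gE hE g0E pqr.
have Sh : gen_pred [set g; h]%classic h.
  by apply/mem_set; apply: sub_gen_smallest; right.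
(* Since x ^ y is y^-1 x y, it is h^-1 that multiplies lengths by alpha. *)
exists (Sub h Sh : gen_group [set g; h]%classic)^-1%g; apply: val_inj.
rewrite gmulfM gmulfJ gmulfV !gmulfXn /= -[sval g0]/(\val g0) g0E.
exact: dilation_conj_translation hE _ _ _ pqr.
Qed.

(** * The four cases *)

Lemma admissible_neq1 (G : groupType) (g : G) n : admissible g n -> g <> 1%g.
Proof.
case=> {G g n} [G g n //|R m m' alpha g h g0 _ _ _ _ gE _ g0E g01
  |G h h' n hh' _ _ /eqP|G h1 h2 n nc _ _ /eqP /commgP/commute_sym//].
  by apply: (translation_neq1 gE); rewrite -g0E g01 val1.
by rewrite mulg_eq1 => /eqP/invg_inj.
Qed.

Lemma admissible_gt0 (G : groupType) (g : G) n : admissible g n -> (0 < n)%N.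
Proof.
case=> {G g n} [G g n _ /ltnW//|R m m' alpha g h g0 m'0 alphaE alpha1 _ _ _ _
  |G h h' n _ /ltnW//|G h1 h2 n _ /ltnW//].
rewrite absz_gt0 subr_eq0; apply: contraNneq alpha1 => mm'.
by rewrite alphaE mm' divff // intr_eq0.
Qed.

Lemma admissible_ideal_gen (G : groupType) (g : G) n (k : fieldType) (c : k) :
  admissible g n -> c != 0 -> c ^+ n != 1 ->
  ideal_gen (gelt g - c%:A) = [set: group_algebra k G]%classic.
Proof.
case=> {G g n} [G g n _ _ gn1|R m m' alpha g h g0 m'0 alphaE _ _ gE hE g0E
  |G h h' n _ _ hX|G h1 h2 n _ _ h12] c0 cn.
- rewrite -[g]mul1g -[X in (X * g)%g]invg1.
  by apply: ideal_gen_equal_powers cn; rewrite expg1n.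
- have [p [q [r [pqr distE]]]] := fraction_natural_relation m'0 alphaE.
  have pqrR : ratr alpha * p%:R + q%:R = r%:R :> R.
    rewrite -(ratr_nat R p) -(ratr_nat R q) -(ratr_nat R r).
    by rewrite -rmorphM -rmorphD pqr.
  have [y yE] := generated_translation_relation gE hE g0E pqrR.
  apply: ideal_gen_conjugate_powers yE _.
  by apply: contraNneq cn => /(expf_distn_eq1 c0); rewrite -distE => ->.
- exact: ideal_gen_equal_powers cn.
- rewrite commgEl; apply: ideal_gen_equal_powers cn.
  by apply/esym; rewrite -conjXg; apply/conjg_fixP/commgP/commute_sym.
Qed.

Theorem corollary5 :
  (forall (G : groupType) (g : G) (n : nat), admissible g n ->
     [/\ g <> 1%g,
         (0 < n)%N
       & forall (k : fieldType) (c : k), c != 0%R -> (c ^+ n)%R != 1%R ->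
           ideal_gen (gelt g - c%:A)%R = [set: group_algebra k G]%classic])
  /\
  (forall G : groupType,
     (exists (g : G) (n : nat), admissible g n) -> ~ resistant G).
Proof.
split=> [G g n adm|G [g [n adm]] res].
  split; [exact: admissible_neq1 adm|exact: admissible_gt0 adm|move=> k c].
  exact: admissible_ideal_gen.
apply: (res rat (gelt g - 2%:A)).
  by rewrite card_msupp_gelt_sub_scalar //; exact: admissible_neq1 adm.
apply: (admissible_ideal_gen adm) => //.
by rewrite gt_eqF // exprn_egt1 // -lt0n (admissible_gt0 adm).
Qed.
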